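(* Let $x_{\mathcal A}=(p_{n,t},q_{n,t})_{n\in\mathcal N,t\in\mathcal T}$ and let $\lambda=(\lambda^{\mathrm p}_{n,t},\lambda^{\mathrm q}_{n,t})_{n\in\mathcal N,t\in\mathcal T}$ be the DLMPs at $x_{\mathcal A}$, i.e. optimal Lagrange multipliers of the power balance constraints at the nodes of $\mathcal N$ in the DSO problem $\mathscr P_0(x_{\mathcal A})$ (see context). Then, for each node $n\in\mathcal N$, the DLMPs are subgradients of the DSO's optimal cost $F$ with respect to $p_n$ and $q_n$ respectively, that is, for all $t\in\mathcal T$, $$\lambda^{\mathrm p}_{n,t}\in\partial_{p_{n,t}}F(x_{\mathcal A}),\qquad \lambda^{\mathrm q}_{n,t}\in\partial_{q_{n,t}}F(x_{\mathcal A}).$$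
   Context: Network. A radial distribution network is a finite tree rooted at node $0$, with node set $\mathcal N_+=\{0,1,\dots,N\}$ and $\mathcal N=\{1,\dots,N\}$; for $n\in\mathcal N$, $n_-$ denotes the parent of $n$. Time periods: $\mathcal T=\{1,\dots,T\}$. Real data: $R_n,X_n,S_n$ ($n\in\mathcal N$), $G_n,B_n,\underline V_n\le\overline V_n$ ($n\in\mathcal N_+$). Variables. $x_0=(p_0,q_0,v,\ell,f,g)$ are the variables of the distribution system operator (DSO): $p_{0,t},q_{0,t}$; $v_{n,t}$ ($n\in\mathcal N_+$); $\ell_{n,t},f_{n,t},g_{n,t}$ ($n\in\mathcal N$), $t\in\mathcal T$, with the convention $f_{0,t}=g_{0,t}=0$. $x_{\mathcal A}=(p_{n,t},q_{n,t})_{n\in\mathcal N,t\in\mathcal T}$ are the nodal net active/reactive consumptions. Branch-flow (SOCP-relaxed) constraints, for all $t\in\mathcal T$: (a) $v_{n,t}-2(R_nf_{n,t}+X_ng_{n,t})+\ell_{n,t}(R_n^2+X_n^2)=v_{n_-,t}$, $n\in\mathcal N$; (b) $f_{n,t}-\sum_{m:m_-=n}(f_{m,t}-\ell_{m,t}R_m)+p_{n,t}+G_nv_{n,t}=0$, $n\in\mathcal N_+$; (c) $g_{n,t}-\sum_{m:m_-=n}(g_{m,t}-\ell_{m,t}X_m)+q_{n,t}-B_nv_{n,t}=0$, $n\in\mathcal N_+$; (d) $f_{n,t}^2+g_{n,t}^2\le v_{n,t}\ell_{n,t}$ with $v_{n,t},\ell_{n,t}\ge0$, $n\in\mathcal N$;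 (e) $f_{n,t}^2+g_{n,t}^2\le S_n^2$, $n\in\mathcal N$; (f) $(f_{n,t}-R_n\ell_{n,t})^2+(g_{n,t}-X_n\ell_{n,t})^2\le S_n^2$, $n\in\mathcal N$; (g) $\underline V_n\le v_{n,t}\le\overline V_n$, $n\in\mathcal N_+$; and $p_{0,t}\le0$. $\mathcal X_0$ is the (convex) set of $x_0$ satisfying all of these constraints except (b), (c) for $n\in\mathcal N$. The coupling constraints (b), (c) for $n\in\mathcal N$, $t\in\mathcal T$ are written $A_0x_0+Bx_{\mathcal A}=b$ (so $b=0$ and $B$ is the identity with the natural ordering, $p_{n,t}$ appearing in the row of (b) and $q_{n,t}$ in the row of (c)). Objective: $\phi_0(x_0)=\sum_t c_t(-p_{0,t})+\alpha_{\mathrm{loss}}\sum_t\sum_{n\in\mathcal N}R_n\ell_{n,t}$, with $c_t(x)=a_tx+b_tx^2$, $a_t,b_t\ge0$, $\alpha_{\mathrm{loss}}\ge0$. $\mathscr P_0(x_{\mathcal A})$: minimize $\phi_0(x_0)$ over $x_0\in\mathcal X_0$ subject to $A_0x_0+Bx_{\mathcal A}=b$. The DSO's optimal cost is $$F(x_{\mathcal A})=\min_{x_0\in\mathcal X_0}\max_{\lambda}\ \phi_0(x_0)+\lambda^\top(A_0x_0+Bx_{\mathcal A}-b)\in\mathbb R\cup\{+\infty\}.$$ DLMPs (distribution locational marginal prices) at $x_{\mathcal A}$: optimal Lagrange multipliers $\lambda=(\lambda^{\mathrm p},\lambda^{\mathrm q})$ of $A_0x_0+Bx_{\mathcal A}=b$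 in $\mathscr P_0(x_{\mathcal A})$, i.e. (strong duality) $F(x_{\mathcal A})$ is finite and $\min_{x_0\in\mathcal X_0}\{\phi_0(x_0)+\lambda^\top(A_0x_0+Bx_{\mathcal A}-b)\}=F(x_{\mathcal A})$. $\partial_{p_{n,t}}F(x_{\mathcal A})$ (resp. $\partial_{q_{n,t}}F(x_{\mathcal A})$) is the convex subdifferential of $F$ with respect to the single coordinate $p_{n,t}$ (resp. $q_{n,t}$), the other coordinates being fixed. *)

(* Defs.v *)
From HB Require Import structures.
From mathcomp Require Import all_boot all_order all_algebra.
From mathcomp Require Import classical_sets reals constructive_ereal ereal.

Set Implicit Arguments.
Unset Strict Implicit.
Unset Printing Implicit Defensive.

Import Order.TTheory GRing.Theory Num.Theory.
Local Open Scope classical_set_scope.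
Local Open Scope ring_scope.

(* The nodes are ['I_N.+1], the root being [ord0]; the non-root nodes are
   indexed by ['I_N], the index [n] standing for the node [node n], i.e. the
   node numbered [n + 1]. *)
Definition node (N : nat) (n : 'I_N) : 'I_N.+1 := lift ord0 n.

(* Extension by 0 at the root of a family indexed by the non-root nodes. *)
Definition ext_root (R : realType) (N : nat) (f : 'I_N -> R) (n : 'I_N.+1) : R :=
  if unlift ord0 n is Some m then f m else 0.

Definition ancestor_step (N : nat) (parent : 'I_N -> 'I_N.+1) (n : 'I_N.+1) :
    'I_N.+1 :=
  if unlift ord0 n is Some m then parent m else ord0.

(* A parent map defines a tree rooted at [ord0] iff following parents leads
   from every node to the root. *)
Definition rooted_tree (N : nat) (parent : 'I_N -> 'I_N.+1) : Prop :=
  forall n : 'I_N.+1, exists k : nat, iter k (ancestor_step parent) n = ord0.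

Record network (R : realType) (N : nat) := Network {
  parent : 'I_N -> 'I_N.+1;
  resistance : 'I_N -> R;
  reactance : 'I_N -> R;
  capacity : 'I_N -> R;
  conductance : 'I_N.+1 -> R;
  susceptance : 'I_N.+1 -> R;
  Vmin : 'I_N.+1 -> R;
  Vmax : 'I_N.+1 -> R;
  network_tree : rooted_tree parent;
  Vmin_le_Vmax : forall n, Vmin n <= Vmax n }.

(* [c_t(x) = cost_lin t * x + cost_quad t * x ^+ 2] *)
Record cost_data (R : realType) (T : nat) := CostData {
  cost_lin : 'I_T -> R;
  cost_quad : 'I_T -> R;
  alpha_loss : R;
  cost_lin_ge0 : forall t, 0 <= cost_lin t;
  cost_quad_ge0 : forall t, 0 <= cost_quad t;
  alpha_loss_ge0 : 0 <= alpha_loss }.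

Record dso_vars (R : realType) (N T : nat) := DsoVars {
  p0 : 'I_T -> R;
  q0 : 'I_T -> R;
  volt : 'I_N.+1 -> 'I_T -> R;
  curr : 'I_N -> 'I_T -> R;
  flowp : 'I_N -> 'I_T -> R;
  flowq : 'I_N -> 'I_T -> R }.

(* Active and reactive components indexed by non-root nodes and periods; used
   both for the consumptions [x_A = (p, q)] and for the multipliers
   [lambda = (lambda^p, lambda^q)]. *)
Record nodal (R : realType) (N T : nat) := Nodal {
  act : 'I_N -> 'I_T -> R;
  react : 'I_N -> 'I_T -> R }.

Section Dso.
Context {R : realType} {N T : nat}.
Variables (net : network R N) (cost : cost_data R T).
Implicit Types (x : dso_vars R N T) (xA lam : nodal R N T).

(* Left-hand sides of the active and reactive power balances at an arbitrary
   node [n], where [pn], [qn] are the net consumptions at [n]. *)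
Definition active_balance x (n : 'I_N.+1) (t : 'I_T) (pn : R) : R :=
  ext_root (fun m => flowp x m t) n
  - \sum_(m < N | parent net m == n) (flowp x m t - curr x m t * resistance net m)
  + pn + conductance net n * volt x n t.

Definition reactive_balance x (n : 'I_N.+1) (t : 'I_T) (qn : R) : R :=
  ext_root (fun m => flowq x m t) n
  - \sum_(m < N | parent net m == n) (flowq x m t - curr x m t * reactance net m)
  + qn - susceptance net n * volt x n t.

(* Branch constraints at the non-root node [node n]. *)
Definition branch_constraints x (n : 'I_N) (t : 'I_T) : Prop :=
  let f := flowp x n t in let g := flowq x n t in
  let l := curr x n t in let v := volt x (node n) t in
  let r := resistance net n in let z := reactance net n in
  let S := capacity net n in
  [/\ v - 2 * (r * f + z * g) + l * (r ^+ 2 + z ^+ 2) = volt x (parent net n) t,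
      [/\ f ^+ 2 + g ^+ 2 <= v * l, 0 <= v & 0 <= l],
      f ^+ 2 + g ^+ 2 <= S ^+ 2 &
      (f - r * l) ^+ 2 + (g - z * l) ^+ 2 <= S ^+ 2].

(* The set [X_0]: all constraints except the power balances at non-root nodes. *)
Definition X0 : set (dso_vars R N T) :=
  [set x | forall t : 'I_T,
    [/\ forall n : 'I_N, branch_constraints x n t,
        forall n : 'I_N.+1, Vmin net n <= volt x n t <= Vmax net n,
        active_balance x ord0 t (p0 x t) = 0,
        reactive_balance x ord0 t (q0 x t) = 0 &
        p0 x t <= 0]].

Definition period_cost (t : 'I_T) (y : R) : R :=
  cost_lin cost t * y + cost_quad cost t * y ^+ 2.

Definition phi0 x : R :=
  \sum_(t < T) period_cost t (- p0 x t)
  + alpha_loss cost * \sum_(t < T) \sum_(n < N) resistance net n * curr x n t.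

(* [phi_0(x_0) + lambda^T (A_0 x_0 + B x_A - b)]; the rows of
   [A_0 x_0 + B x_A - b] are the power balances at the non-root nodes. *)
Definition lagrangian xA x lam : R :=
  phi0 x + \sum_(t < T) \sum_(n < N)
    (act lam n t * active_balance x (node n) t (act xA n t)
     + react lam n t * reactive_balance x (node n) t (react xA n t)).

(* Minima and maxima are taken as infima and suprema in [\bar R]; on the
   empty set the infimum is [+oo]. *)
Definition F xA : \bar R :=
  ereal_inf [set ereal_sup [set (lagrangian xA x lam)%:E | lam in setT]
            | x in X0].

Definition dual_value xA lam : \bar R :=
  ereal_inf [set (lagrangian xA x lam)%:E | x in X0].

Definition is_DLMP xA lam : Prop :=
  F xA \is a fin_num /\ dual_value xA lam = F xA.

End Dso.

(* Empty at points where [h] is infinite. *)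
Definition subdifferential (R : realType) (h : R -> \bar R) (y : R) : set R :=
  [set s | h y \is a fin_num /\
           forall z : R, (h y + (s * (z - y))%:E <= h z)%E].

Definition set_coord (R : realType) (N T : nat) (p : 'I_N -> 'I_T -> R)
    (n : 'I_N) (t : 'I_T) (y : R) : 'I_N -> 'I_T -> R :=
  fun m u => if (m == n) && (u == t) then y else p m u.

Definition partial_act (R : realType) (N T : nat) (h : nodal R N T -> \bar R)
    (n : 'I_N) (t : 'I_T) (xA : nodal R N T) : set R :=
  subdifferential (fun y => h (Nodal (set_coord (act xA) n t y) (react xA)))
    (act xA n t).

Definition partial_react (R : realType) (N T : nat) (h : nodal R N T -> \bar R)
    (n : 'I_N) (t : 'I_T) (xA : nodal R N T) : set R :=
  subdifferential (fun y => h (Nodal (act xA) (set_coord (react xA) n t y)))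
    (react xA n t).

(* Main.v *)
(* Changing the consumptions from [xA] to [yA] shifts the Lagrangian at fixed
   multipliers [lam] by the constant [lam^T (yA - xA)], hence shifts the dual
   value by the same constant.  Since the dual value equals [F] at [xA] (strong
   duality) and bounds [F] from below at [yA] (weak duality), [lam] is a
   subgradient of [F] jointly in all coordinates; each single-coordinate claim
   is a restriction of this inequality. *)
Require Import Defs.
From HB Require Import structures.
From mathcomp Require Import all_boot all_order all_algebra.
From mathcomp Require Import boolp.
From mathcomp Require Import classical_sets reals constructive_ereal ereal.
From mathcomp Require Import ring.

Set Implicit Arguments.
Unset Strict Implicit.
Unset Printing Implicit Defensive.

Import Order.TTheory GRing.Theory Num.Theory.
Local Open Scope classical_set_scope.
Local Open Scope ring_scope.

Definition pairing (R : realType) (N T : nat) (lam d : nodal R N T) : R :=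
  \sum_(t < T) \sum_(n < N)
    (act lam n t * act d n t + react lam n t * react d n t).

Definition nodal_sub (R : realType) (N T : nat) (yA xA : nodal R N T) :=
  Nodal (fun n t => act yA n t - act xA n t)
        (fun n t => react yA n t - react xA n t).

(** Each consumption enters its own balance with coefficient one and does not enter [phi0]. *)
Lemma lagrangian_shift (R : realType) (N T : nat) (net : network R N)
    (cost : cost_data R T) (xA yA lam : nodal R N T) (x : dso_vars R N T) :
  lagrangian net cost yA x lam =
  lagrangian net cost xA x lam + pairing lam (nodal_sub yA xA).
Proof.
rewrite /lagrangian /pairing -[RHS]addrA; congr (_ + _).
rewrite -big_split /=; apply: eq_bigr => t _.
rewrite -big_split /=; apply: eq_bigr => n _.
by rewrite /active_balance /reactive_balance; ring.
Qed.

Lemma DLMP_subgradient (R : realType) (N T : nat) (net : network R N)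
    (cost : cost_data R T) (xA yA lam : nodal R N T) :
  is_DLMP net cost xA lam ->
  (F net cost xA + (pairing lam (nodal_sub yA xA))%:E <= F net cost yA)%E.
Proof.
move=> [_ <-]; apply: le_ereal_inf_tmp => _ [x X0x <-].
(* Since [X0] does not depend on the consumptions, the same [x] is admissible in the dual value at
   [xA]. *)
apply: (@le_trans _ _ (lagrangian net cost yA x lam)%:E); last first.
  by apply: ereal_sup_ubound; exists lam.
rewrite (lagrangian_shift net cost xA) EFinD leeD2r //.
by apply: ereal_inf_lbound; exists x.
Qed.

Lemma set_coord_id (R : realType) (N T : nat) (p : 'I_N -> 'I_T -> R) n t :
  set_coord p n t (p n t) = p.
Proof.
apply/funext => m; apply/funext => u; rewrite /set_coord.
by case: ifP => // /andP[/eqP-> /eqP->].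
Qed.

(** Collapses the pairing when a single coordinate moves: all other differences vanish. *)
Lemma sum_set_coord (R : realType) (N T : nat) (l p : 'I_N -> 'I_T -> R) n t y :
  \sum_(u < T) \sum_(m < N) l m u * (set_coord p n t y m u - p m u) =
  l n t * (y - p n t).
Proof.
rewrite (bigD1 t) //= (bigD1 n) //= /set_coord !eqxx /=.
rewrite big1 => [|m /negPf-> /=]; last by rewrite subrr mulr0.
rewrite big1 => [|u /negPf ut]; first by rewrite !addr0.
by rewrite big1 // => m _; rewrite ut andbF subrr mulr0.
Qed.

Theorem proposition3 (R : realType) (N T : nat) (net : network R N)
    (cost : cost_data R T) (xA lam : nodal R N T)
    (Hlam : is_DLMP net cost xA lam) :
  forall (n : 'I_N) (t : 'I_T),
    act lam n t \in partial_act (F net cost) n t xA /\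
    react lam n t \in partial_react (F net cost) n t xA.
Proof.
have [Ffin _] := Hlam.
have xAE : Nodal (act xA) (react xA) = xA by case: (xA).
move=> n t; split; rewrite inE; split; rewrite set_coord_id xAE // => z.
(* The slope term is expanded into a double sum to match [pairing] termwise; the reactive
   differences are zero. *)
- rewrite -sum_set_coord.
  apply: le_trans (DLMP_subgradient _ Hlam); rewrite leeD2l // lee_fin.
  apply: ler_sum => u _; apply: ler_sum => m _ /=.
  by rewrite subrr mulr0 addr0.
- rewrite -sum_set_coord.
  apply: le_trans (DLMP_subgradient _ Hlam); rewrite leeD2l // lee_fin.
  apply: ler_sum => u _; apply: ler_sum => m _ /=.
  by rewrite subrr mulr0 add0r.
Qed.
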